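(* Let $X$ be a linearly ordered set, let $D$ be an ultrafilter over some set $I$, and let $(x_i)_{i\in I}$ be a sequence of elements of $X$. Set $$A=\{x\in X \mid \{i\in I\mid x<x_i\}\in D\},\qquad B=\{x\in X\mid \{i\in I\mid x_i<x\}\in D\}.$$ Then the following statements hold. (1) $x\in X\setminus(A\cup B)$ if and only if $\{i\in I\mid x_i=x\}\in D$. (2) $|X\setminus (A\cup B)|\leq 1$. (3) If $x\in X\setminus(A\cup B)$, then $a<x$ for every $a\in A$, and $x<b$ for every $b\in B$. (4) If $a\in A$ and $b\in B$, then $\{i\in I\mid x_i\in(a,b)\}$ belongs to $D$, hence it is not empty. (5) If $a\in A$ and $b\in B$, then $a<b$. (6) If $X=A\cup B$, then either $A$ has no maximum or $B$ has no minimum. (7) If $X$ is a GO space, then $(x_i)_{i\in I}$ $D$-converges to $x\in X$ if and only if one of the following (mutually exclusive) conditions holds: (a) $\{i\in I\mid x_i=x\}\in D$; or (b) $x$ is the maximum of $A$ and $x\in\overline{B}$; or (c) $x$ is the minimum of $B$ and $x\in\overline{A}$. (8) If $X$ is a LOTS, then $(x_i)_{i\in I}$ $D$-converges to $x\in X$ if and only if either (a) $\{i\in I\mid x_i=x\}\in D$; or (b) $x$ is the maximum of $A$ and $A\cup B=X$; or (c) $x$ is the minimum of $B$ and $A\cup B=X$. (9) If $X$ is a GO space, then $(x_i)_{i\in I}$ $D$-converges to some $x\in X$ if and only if $(A,B)$ is neither a gap nor a pseudo-gap of $X$. In particular, if $X$ is a LOTS, then $(x_i)_{i\in I}$ $D$-converges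 in $X$ if and only if $(A,B)$ is not a gap. (10) Suppose that $X$ is a GO space and that $X=A\cup B$. For $i\in I$, put $$O_i=\begin{cases}\bigcup_{a\in A}(x_i,a) & \text{if } x_i\in A,\\ \bigcup_{b\in B}(b,x_i) & \text{if } x_i\in B.\end{cases}$$ Then $(x_i)_{i\in I}$ $D$-converges to $x$ if and only if $x$ is a $D$-limit point of $(O_i)_{i\in I}$.
   Context: A LOTS (linearly ordered topological space) is a linearly ordered set endowed with the open interval topology. A GO space (generalized ordered topological space) is a linearly ordered set with a Hausdorff topology having a base of order-convex sets. Intervals $(a,b)=\{y\in X\mid a<y<b\}$ are computed in $X$, and $\overline{Y}$ denotes the topological closure of $Y$ in $X$. Ultrafilters are proper. If $D$ is an ultrafilter over $I$, a sequence $(x_i)_{i\in I}$ in a topological space $X$ $D$-converges to $x\in X$ if $\{i\in I\mid x_i\in U\}\in D$ for every open neighborhood $U$ of $x$. If $(Y_i)_{i\in I}$ is a sequence of subsets of $X$, a point $x\in X$ is a $D$-limit point of $(Y_i)_{i\in I}$ if $\{i\in I\mid U\cap Y_i\neq\emptyset\}\in D$ for every neighborhood $U$ of $x$. Let $X$ be a GO space and consider ordered pairs $(A,B)$ of open subsets of $X$ such that $A\cup B=X$ and $a<b$ for every $a\in A$, $b\in B$. Such a pair is a gap of $X$ if $A$ has no maximum and $B$ has no minimum ($A$ or $B$ is allowed to be empty). Such a pair is a pseudo-gap of $X$ if $A$ and $B$ are both nonempty and either $A$ has a maximum and $B$ has no minimum, or $A$ has no maximum and $B$ has a minimum. *)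

(* Defs.v *)
From mathcomp Require Export all_boot all_order.
From mathcomp Require Export boolp classical_sets functions cardinality.
From mathcomp Require Export interval set_interval filter topology.

Set Implicit Arguments.
Unset Strict Implicit.
Unset Printing Implicit Defensive.

Import Order.TTheory.
Local Open Scope order_scope.
Local Open Scope classical_set_scope.

Section order_defs.
Context {d : Order.disp_t} {X : porderType d}.
Implicit Types S C : set X.

Definition is_maximum S (m : X) : Prop := S m /\ ubound S m.

Definition is_minimum S (m : X) : Prop := S m /\ lbound S m.

Definition order_convex C : Prop :=
  forall y z, C y -> C z -> forall w, y <= w <= z -> C w.

End order_defs.

(* The library has no join of Order.Total and Topological short of
   OrderTopological (the LOTS), so totality is part of the predicate. *)
Definition GO_space {d : Order.disp_t} (X : POrderedTopological.type d) : Prop :=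
  [/\ total (<=%O : rel X),
      hausdorff_space X
    & exists2 B : set (set X), basis B & forall C, B C -> order_convex C].

Lemma orderTopological_GO_space (d : Order.disp_t)
  (X : orderTopologicalType d) : GO_space X.
Proof.
split; [exact: le_total|exact: order_hausdorff|].
exists [set C : set X | open C /\ order_convex C]; last by move=> C [].
split=> [C []//|x U]; rewrite itv_nbhsE => -[i [oi xi] iU].
exists [set` i] => //; split=> //; split; first exact: itv_open_ends_open.
move=> y z /= yi zi w /andP[yw wz]; case: i {oi xi iU} yi zi => l u.
rewrite /= !itv_boundlr => /andP[ly _] /andP[_ zu]; apply/andP; split.
  by apply: le_trans ly _; rewrite bnd_simp.
by apply: le_trans zu; rewrite bnd_simp.
Qed.

Section gaps.
Context {d : Order.disp_t} {X : POrderedTopological.type d}.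
Implicit Types A B : set X.

(* A and B may be empty here: the exclusion of empty parts is specific to
   pseudo-gaps. *)
Definition is_open_cut A B : Prop :=
  [/\ open A, open B, A `|` B = setT & forall a b, A a -> B b -> a < b].

Definition is_gap A B : Prop :=
  [/\ is_open_cut A B, ~ (exists m, is_maximum A m)
    & ~ (exists m, is_minimum B m)].

Definition is_pseudo_gap A B : Prop :=
  [/\ is_open_cut A B, A !=set0, B !=set0
    & ((exists m, is_maximum A m) /\ ~ (exists m, is_minimum B m))
      \/ (~ (exists m, is_maximum A m) /\ (exists m, is_minimum B m))].

End gaps.

Section ultrafilter_defs.
Context {I : Type} (D : set_system I).

Definition lower_part {d : Order.disp_t} {X : porderType d} (x : I -> X) :
  set X := [set y | D [set i | y < x i]].

Definition upper_part {d : Order.disp_t} {X : porderType d} (x : I -> X) :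
  set X := [set y | D [set i | x i < y]].

Definition limit_point_along {X : topologicalType} (Y : I -> set X) (y : X) :
  Prop := forall U, nbhs y U -> D [set i | U `&` Y i !=set0].

(* Only meant for lower_part D x `|` upper_part D x = setT, when the second
   branch is exactly the case where x i lies in the upper part. *)
Definition tail_intervals {d : Order.disp_t} {X : porderType d} (x : I -> X)
    (i : I) : set X :=
  if x i \in lower_part x then \bigcup_(a in lower_part x) `]x i, a[%classic
  else \bigcup_(b in upper_part x) `]b, x i[%classic.

End ultrafilter_defs.

(* Main.v *)
From HB Require Import structures.
Require Import Defs.

Set Implicit Arguments.
Unset Strict Implicit.
Unset Printing Implicit Defensive.

Import Order.TTheory.
Local Open Scope order_scope.
Local Open Scope classical_set_scope.

(** Each point y of X satisfies exactly one of: D-many x_i lie above y (y is in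
    A), D-many equal y, D-many lie below y (y is in B); this is trichotomy in X
    pushed through the ultrafilter, and the statements about a bare linear order
    follow from it, because finitely many D-large sets have a common index.

    In a GO space, convex neighbourhoods reduce convergence to the cut (A, B).
    If y is in the closures of both A and B, a convex neighbourhood of y
    contains some a in A and b in B, hence every x_i between a and b, and these
    are D-many ([closures_cvg]). Conversely, let (x_i) converge to a point y of
    A. An open ray below a point of A cannot contain D-many x_i, so y is the
    maximum of A; and D-many x_i lie above y and in any given neighbourhood
    of y. Such an x_i is not in A, and by uniqueness of limits it is not a value
    taken by D-many x_j, so it lies in B: y is in the closure of B
    ([cvg_lower]).

    If there is no limit, then A and B cover X and no point is in both closures,
    so both are closed and the cut is open ([not_cvg_open_cut]); an open cut
    separates a point of A from B and so excludes limits ([open_cut_not_cvg]).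
    As A has no maximum or B has no minimum, an open cut of this kind is a gap
    or a pseudo-gap. In a LOTS, a maximum y of A is automatically in the
    closure of B: an interval to the right of y is either a final segment, which
    contains some x_i, or ends at a point of B with some x_i in between.

    For the tail intervals, if y is in A and A, B cover X, both convergence to y
    and being a limit point force y to be the maximum of A; then D-many x_i lie
    in B, where the tail interval of x_i is the part of B below x_i, as B has no
    minimum.

    Everything is symmetric under reversal of the order, which exchanges A and
    B, so each one-sided fact is proved for A and read in the dual order for
    B. *)

Lemma subset1_card_le1 (T : Type) (S : set T) :
  is_subset1 S -> (S #<= `I_1)%card.
Proof.
move=> S1; have [->|/set0P[z Sz]] := eqVneq S set0; first by rewrite card_ge0.
rewrite -(card_le_eqr (@card_set1 _ z)).
by apply: subset_card_le => w Sw; exact: S1.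
Qed.

(** Unfolds the image filter, so that the filter lemmas apply to D itself. *)
Lemma cvg_alongP (X : topologicalType) (I : Type) (D : set_system I)
    (x : I -> X) (y : X) :
  x @ D --> y <-> forall U, nbhs y U -> D [set i | U (x i)].
Proof. by []. Qed.

(** * The cut of a linear order determined by an ultrafilter *)

Section ultrafilter_cut.
Context {d : Order.disp_t} {X : porderType d} {I : Type} (D : set_system I).
Context {UD : UltraFilter D} (x : I -> X).
Local Notation A := (lower_part D x).
Local Notation B := (upper_part D x).

Lemma between_parts a b : A a -> B b -> D [set i | a < x i < b].
Proof. by move=> Aa Bb; apply: (filterS2 _ _ Aa Bb) => i /= -> ->. Qed.

Lemma lower_lt_upper a b : A a -> B b -> a < b.
Proof.
move=> Aa Bb; have [i /andP[ai ib]] := filter_ex (between_parts Aa Bb).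
exact: lt_trans ai ib.
Qed.

Lemma lower_notin_upper y : A y -> ~ B y.
Proof. by move=> Ay By; have := lower_lt_upper Ay By; rewrite ltxx. Qed.

Lemma lower_not_eventually_eq y : A y -> ~ D [set i | x i = y].
Proof.
move=> Ay Ey; have [i [/= + E]] := filter_ex (filterI Ay Ey).
by rewrite E ltxx.
Qed.

Lemma upper_not_eventually_eq y : B y -> ~ D [set i | x i = y].
Proof.
move=> By Ey; have [i [/= + E]] := filter_ex (filterI By Ey).
by rewrite E ltxx.
Qed.

Lemma eventually_eq_unique y z :
  D [set i | x i = y] -> D [set i | x i = z] -> y = z.
Proof. by move=> Ey Ez; have [i [<- <-]] := filter_ex (filterI Ey Ez). Qed.

Hypothesis tot : total (<=%O : rel X).

Lemma total_trichotomy (y z : X) : [\/ y < z, y = z | z < y].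
Proof.
have [->|yz] := eqVneq y z; first by constructor 2.
have /orP[h|h] := tot y z; first by constructor 1; rewrite lt_neqAle yz.
by constructor 3; rewrite lt_neqAle eq_sym yz.
Qed.

(** An ultrafilter decides both y < x_i and x_i < y; if it rejects both, x_i = y
    for D-many i by totality. *)
Lemma parts_trichotomy y : [\/ A y, D [set i | x i = y] | B y].
Proof.
have [Ay|nA] := in_ultra_setVsetC [set i | y < x i] UD.
  by constructor 1.
have [By|nB] := in_ultra_setVsetC [set i | x i < y] UD.
  by constructor 3.
constructor 2; apply: (filterS2 _ _ nA nB) => i /= nyx nxy.
by have [|->|] := total_trichotomy (x i) y.
Qed.

Lemma setC_parts y : (setT `\` (A `|` B)) y <-> D [set i | x i = y].
Proof.
split=> [[_ nAB]|Ey].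
  by have [Ay||By] := parts_trichotomy y => //; case: nAB; [left|right].
split=> // -[Ay|By].
  exact: lower_not_eventually_eq Ay Ey.
exact: upper_not_eventually_eq By Ey.
Qed.

Lemma eventually_eq_gt y a : D [set i | x i = y] -> A a -> a < y.
Proof. by move=> Ey Aa; have [i [/= <-]] := filter_ex (filterI Ey Aa). Qed.

Lemma eventually_eq_lt y b : D [set i | x i = y] -> B b -> y < b.
Proof. by move=> Ey Bb; have [i [/= <-]] := filter_ex (filterI Ey Bb). Qed.

Hypothesis cover : A `|` B = setT.

Lemma coverP y : A y \/ B y.
Proof. by have : setT y by []; rewrite -cover. Qed.

Lemma maximum_lt_upper m y : is_maximum A m -> m < y -> B y.
Proof.
by move=> [_ mA] my; have [/mA/(lt_le_trans my)|//] := coverP y; rewrite ltxx.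
Qed.

Lemma minimum_gt_lower m y : is_minimum B m -> y < m -> A y.
Proof.
by move=> [_ mB] ym; have [//|/mB/(lt_le_trans ym)] := coverP y; rewrite ltxx.
Qed.

Lemma maximum_upper_neq0 m : is_maximum A m -> B !=set0.
Proof.
move=> mA; have [i mi] := filter_ex mA.1.
by exists (x i); exact: maximum_lt_upper mA mi.
Qed.

Lemma minimum_lower_neq0 m : is_minimum B m -> A !=set0.
Proof.
move=> mB; have [i mi] := filter_ex mB.1.
by exists (x i); exact: minimum_gt_lower mB mi.
Qed.

(** D-many x_i would lie strictly between the maximum of A and the minimum of B,
    where the cover leaves no point. *)
Lemma no_maximum_and_minimum m n : is_maximum A m -> ~ is_minimum B n.
Proof.
move=> mA nB; have [i /andP[mi ni]] := filter_ex (between_parts mA.1 nB.1).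
have := lower_notin_upper (minimum_gt_lower nB ni).
by apply; exact: maximum_lt_upper mA mi.
Qed.

(** A has a maximum, so B has no minimum. *)
Lemma upper_downward m b : is_maximum A m -> B b -> exists2 z, B z & z < b.
Proof.
move=> mA Bb; apply: contrapT => nz.
apply: (no_maximum_and_minimum mA (n := b)).
split=> // z Bz; have [//|h] := orP (tot b z).
have [zb|->|/ltW//] := total_trichotomy z b => //.
by case: nz; exists z.
Qed.

Lemma tail_intervals_lower i : A (x i) ->
  tail_intervals D x i = \bigcup_(a in A) `]x i, a[%classic.
Proof. by rewrite /tail_intervals -in_setE => ->. Qed.

Lemma tail_intervals_upper i : B (x i) ->
  tail_intervals D x i = \bigcup_(b in B) `]b, x i[%classic.
Proof.
move=> Bi; rewrite /tail_intervals ifF //; apply/negP; rewrite in_setE => Ai.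
exact: lower_notin_upper Ai Bi.
Qed.

End ultrafilter_cut.

(** * Reversing the order *)

Section dual_order.
Context {d : Order.disp_t}.

(* With the topology of X on the dual order, a statement about lower parts read
   in X^d is, by conversion, the mirror statement about upper parts in X. *)
HB.instance Definition _ (X : POrderedTopological.type d) :=
  Topological.copy X^d X.

Context {X : POrderedTopological.type d}.

Lemma GO_space_dual : GO_space X -> GO_space X^d.
Proof.
move=> [tot hX [B bB cB]]; split; [by move=> y z; exact: tot|exact: hX|].
exists B; first exact: bB.
by move=> C BC y z Cy Cz w /andP[yw wz]; apply: (cB C BC z y) => //; apply/andP.
Qed.

(** The definition tests membership in the lower part only, so it is
    self-dual only when the two parts cover X. *)
Lemma tail_intervals_dual (I : Type) (D : set_system I) (UD : UltraFilter D)
    (x : I -> X) : lower_part D x `|` upper_part D x = setT ->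
  tail_intervals D (x : I -> X^d) = tail_intervals D x.
Proof.
move=> cov; have covd : lower_part D (x : I -> X^d)
    `|` upper_part D (x : I -> X^d) = setT by rewrite setUC.
have swap (a b : X) :
    [set` `](a : X^d), (b : X^d)[%O] = [set` `]b, a[%O] :> set X.
  by apply/seteqP; split=> z; rewrite /= !in_itv /= andbC.
apply/funext => i; have [Ai|Bi] := coverP cov (x i).
  rewrite (tail_intervals_lower Ai).
  rewrite (@tail_intervals_upper _ X^d _ _ _ _ _ Ai).
  by apply: eq_bigcupr => a _; rewrite swap.
rewrite (tail_intervals_upper Bi) (@tail_intervals_lower _ X^d _ _ _ _ Bi).
by apply: eq_bigcupr => b _; rewrite swap.
Qed.

End dual_order.

(** * Convergence in GO spaces *)

Section GO_convergence.
Context {d : Order.disp_t} {X : POrderedTopological.type d} {I : Type}.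
Context (D : set_system I) {UD : UltraFilter D} (x : I -> X).
Hypothesis GO : GO_space X.
Local Notation A := (lower_part D x).
Local Notation B := (upper_part D x).

Let tot : total (<=%O : rel X). Proof. by case: GO. Qed.
Let hausX : hausdorff_space X. Proof. by case: GO. Qed.

Lemma convex_nbhs (y : X) U : nbhs y U ->
  exists C, [/\ nbhs y C, order_convex C & C `<=` U].
Proof.
case: GO => _ _ [BB [oBB bBB] cBB] /(bBB y)[C [BC Cy] CU].
exists C; split=> //; last exact: cBB.
by apply: open_nbhs_nbhs; split=> //; exact: oBB.
Qed.

(** Points are closed, so y has a convex neighbourhood missing a; by convexity
    it cannot reach beyond a. *)
Lemma nbhs_lt (y a : X) : y < a -> nbhs y [set z | z < a].
Proof.
move=> ya; have /convex_nbhs[C [yC cC Ca]] : nbhs y (~` [set a]).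
  apply: open_nbhs_nbhs; split; last by move=> E; rewrite /= E ltxx in ya.
  exact/closed_openC/accessible_closed_set1/hausdorff_accessible.
apply: (filterS _ yC) => w Cw /=; have [//|wa|aw] := total_trichotomy tot w a.
  by case: (Ca w Cw).
case: (Ca a _ erefl); apply: (cC y w (nbhs_singleton yC) Cw).
by rewrite !ltW.
Qed.

Lemma eventually_eq_cvg (y : X) : D [set i | x i = y] -> x @ D --> y.
Proof.
move=> Ey; apply/cvg_alongP => U /nbhs_singleton Uy.
by apply: filterS Ey => i /= ->.
Qed.

(** A convex neighbourhood of y meets A and B, hence contains an interval
    between the two parts, where D-many x_i lie. *)
Lemma closures_cvg (y : X) : closure A y -> closure B y -> x @ D --> y.
Proof.
move=> yA yB; apply/cvg_alongP => U /convex_nbhs[C [yC cC CU]].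
have [a [Aa Ca]] := yA _ yC; have [b [Bb Cb]] := yB _ yC.
apply: filterS (between_parts Aa Bb) => i /andP[ai ib].
by apply/CU/(cC a b) => //; rewrite !ltW.
Qed.

(** If a in A were above y, D-many x_i would lie below a, contradicting a in A.
    Once y is the maximum of A, an x_i above y is not in A, and D-many x_j
    cannot equal it, since x_i would then be a second limit. *)
Lemma cvg_lower (y : X) : x @ D --> y -> A y -> is_maximum A y /\ closure B y.
Proof.
move=> xy Ay; have /cvg_alongP nxy := xy; have yA : is_maximum A y.
  split=> // a Aa; have [/ltW//|->//|ya] := total_trichotomy tot a y.
  by have := lower_notin_upper Aa (nxy _ (nbhs_lt ya)).
split=> // U yU; have [i [yi Ui]] := filter_ex (filterI Ay (nxy _ yU)).
exists (x i); split=> //.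
have [/yA.2/(lt_le_trans yi)||//] := parts_trichotomy x tot (x i).
  by rewrite ltxx.
move=> /eventually_eq_cvg xxi; move: yi => /=.
by rewrite (cvg_unique hausX xy xxi) ltxx.
Qed.

(** A point outside both parts is a limit, and so is a point in both closures.
    Without a limit, A and B are therefore complementary, and closed. *)
Lemma not_cvg_open_cut : ~ (exists y : X, x @ D --> y) -> is_open_cut A B.
Proof.
move=> ncvg; have cov : A `|` B = setT.
  apply/seteqP; split=> // y _.
  have [|/eventually_eq_cvg xy|] := parts_trichotomy x tot y.
  - by left.
  - by case: ncvg; exists y.
  - by right.
have ncl y : closure A y -> ~ closure B y.
  by move=> yA yB; apply: ncvg; exists y; exact: closures_cvg.
have AB : A = ~` B.
  apply/seteqP; split=> y; first exact: lower_notin_upper.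
  by have [|//] := coverP cov y.
split=> //; last exact: lower_lt_upper.
  rewrite AB; apply: closed_openC => y yB; have [Ay|//] := coverP cov y.
  by case: (ncl y) => //; exact: subset_closure.
rewrite -[B]setCK -AB; apply: closed_openC => y yA.
have [//|By] := coverP cov y.
by case: (ncl y) => //; exact: subset_closure.
Qed.

(** The extremum of one part witnesses that the other part is nonempty, as
    pseudo-gaps demand: some x_i lies beyond it. *)
Lemma open_cut_gap : is_open_cut A B -> is_gap A B \/ is_pseudo_gap A B.
Proof.
move=> cut; have [_ _ cov _] := cut.
have [[m mA]|nmax] := pselect (exists m, is_maximum A m).
  right; split=> //; [by exists m; case: mA|exact: maximum_upper_neq0 mA|].
  left; split; first by exists m.
  by move=> [n]; exact: no_maximum_and_minimum mA.
have [[n nB]|nmin] := pselect (exists m, is_minimum B m); last by left.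
right; split=> //; [exact: minimum_lower_neq0 nB|by exists n; case: nB|].
by right; split=> //; exists n.
Qed.

End GO_convergence.

Section GO_convergence_both_sides.
Context {d : Order.disp_t} {X : POrderedTopological.type d} {I : Type}.
Context (D : set_system I) {UD : UltraFilter D} (x : I -> X).
Hypothesis GO : GO_space X.
Local Notation A := (lower_part D x).
Local Notation B := (upper_part D x).

Let tot : total (<=%O : rel X). Proof. by case: GO. Qed.

Lemma cvg_upper (y : X) : x @ D --> y -> B y -> is_minimum B y /\ closure A y.
Proof. exact: (@cvg_lower _ X^d _ _ _ _ (GO_space_dual GO)). Qed.

Lemma cvg_eventually_eq_or_extremum (y : X) : x @ D --> y <->
  D [set i | x i = y] \/
  (is_maximum A y /\ closure B y) \/ (is_minimum B y /\ closure A y).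
Proof.
split=> [xy|[Ey|[[[Ay _] yB]|[[By _] yA]]]].
- have [Ay|Ey|By] := parts_trichotomy x tot y.
  + by right; left; exact: cvg_lower.
  + by left.
  + by right; right; exact: cvg_upper.
- exact: eventually_eq_cvg.
- by apply: closures_cvg => //; exact: subset_closure.
- by apply: closures_cvg => //; exact: subset_closure.
Qed.

(** A limit in A would be in the closure of B, but the open set A is a
    neighbourhood of it disjoint from B. *)
Lemma open_cut_not_cvg (y : X) : is_open_cut A B -> ~ x @ D --> y.
Proof.
move=> [oA oB cov _] xy; have [Ay|By] := coverP cov y.
  have [_ /(_ A)[|z []]] := cvg_lower GO xy Ay; first exact: open_nbhs_nbhs.
  by move=> Bz Az; exact: lower_notin_upper Az Bz.
have [_ /(_ B)[|z []]] := cvg_upper xy By; first exact: open_nbhs_nbhs.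
exact: lower_notin_upper.
Qed.

Lemma ex_cvg_not_gap : (exists y : X, x @ D --> y) <->
  ~ is_gap A B /\ ~ is_pseudo_gap A B.
Proof.
split=> [[y xy]|[ng nps]].
  by split=> -[cut *]; exact: open_cut_not_cvg cut xy.
apply: contrapT => /(not_cvg_open_cut GO)/open_cut_gap[//|//].
Qed.

End GO_convergence_both_sides.

(** * Limit points of the tail intervals *)

Section tail_limit_points.
Context {d : Order.disp_t} {I : Type} (D : set_system I) {UD : UltraFilter D}.

(** Both properties make y the maximum of A, so D-many x_i lie above y and in B.
    The tail interval of such an x_i lies in B between y and x_i: if x_i is in
    a convex neighbourhood of y, so is its tail interval, which is nonempty
    because B has no minimum; and a point of it near y puts y in the closure
    of B. *)
Lemma lower_cvg_limit_point (X : POrderedTopological.type d) (x : I -> X)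
    (y : X) :
  GO_space X -> lower_part D x `|` upper_part D x = setT -> lower_part D x y ->
  x @ D --> y <-> limit_point_along D (tail_intervals D x) y.
Proof.
move=> GO cov Ay; have [tot _ _] := GO; split=> [xy U|lim].
  have [mA _] := cvg_lower GO xy Ay.
  move=> /(convex_nbhs GO)[C [yC cC CU]].
  apply: (filterS2 _ _ Ay ((cvg_alongP _ _ _).1 xy _ yC)) => i /= yi Ci.
  have Bi := maximum_lt_upper cov mA yi.
  have [z Bz zi] := upper_downward tot cov mA Bi.
  have [b Bb bz] := upper_downward tot cov mA Bz.
  exists z; split.
    apply/CU/(cC y (x i) (nbhs_singleton yC) Ci).
    by rewrite (ltW zi) andbT ltW // (lower_lt_upper Ay Bz).
  by rewrite tail_intervals_upper //; exists b => //=; rewrite in_itv /= bz.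
(* For a > y in A, some x_i > a has a tail interval meeting the ray below a; but
   that interval lies above x_i or above a point of B, hence above a. *)
have mA : is_maximum (lower_part D x) y.
  split=> // a Aa; have [/ltW//|->//|ya] := total_trichotomy tot a y.
  have [i [ai [z [/= za]]]] := filter_ex (filterI Aa (lim _ (nbhs_lt GO ya))).
  have [Ai|Bi] := coverP cov (x i).
    rewrite tail_intervals_lower // => -[a' _ /=].
    rewrite in_itv /= => /andP[iz _].
    by have := lt_trans za (lt_trans ai iz); rewrite ltxx.
  rewrite tail_intervals_upper // => -[b Bb /=].
  rewrite in_itv /= => /andP[bz _].
  have ab : a < b by exact: lower_lt_upper Aa Bb.
  by have := lt_trans za (lt_trans ab bz); rewrite ltxx.
apply: (closures_cvg GO); first exact: subset_closure.
move=> U yU; have [i [yi [z [Uz]]]] := filter_ex (filterI Ay (lim _ yU)).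
have Bi := maximum_lt_upper cov mA yi.
rewrite tail_intervals_upper // => -[b Bb /=].
rewrite in_itv /= => /andP[bz _].
exists z; split=> //; apply: maximum_lt_upper mA _ => //.
exact: lt_trans (lower_lt_upper Ay Bb) bz.
Qed.

End tail_limit_points.

Lemma cvg_limit_point (d : Order.disp_t) (X : POrderedTopological.type d)
    (I : Type) (D : set_system I) (UD : UltraFilter D) (x : I -> X) (y : X) :
  GO_space X -> lower_part D x `|` upper_part D x = setT ->
  x @ D --> y <-> limit_point_along D (tail_intervals D x) y.
Proof.
move=> GO cov; have [Ay|By] := coverP cov y; first exact: lower_cvg_limit_point.
have := @lower_cvg_limit_point _ _ D UD X^d x y (GO_space_dual GO).
by rewrite (tail_intervals_dual UD cov) setUC; exact.
Qed.

(** * Convergence in linearly ordered topological spaces *)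

(** The right half of the fact that, in an order topology, every neighbourhood of
    y contains an open interval or ray around y. With the halves separated, the
    left one is the same property in the dual order, and the dual needs no order
    topology of its own. *)
Definition right_interval_nbhs (d : Order.disp_t)
    (X : POrderedTopological.type d) (y : X) : Prop :=
  forall U, nbhs y U -> (forall w, y <= w -> U w) \/
    exists2 u, y < u & forall w, y <= w -> w < u -> U w.

(** To the right of y, a neighbourhood contains either everything, so some x_i,
    or all points up to some u > y; then u is in B, and D-many x_i are between y
    and u. *)
Lemma maximum_closure_upper (d : Order.disp_t)
    (X : POrderedTopological.type d) (I : Type) (D : set_system I)
    (UD : UltraFilter D) (x : I -> X) (y : X) :
  right_interval_nbhs y -> lower_part D x `|` upper_part D x = setT ->
  is_maximum (lower_part D x) y -> closure (upper_part D x) y.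
Proof.
move=> ry cov mA U /ry[Ur|[u yu Uu]].
  have [i yi] := filter_ex mA.1.
  by exists (x i); split; [exact: maximum_lt_upper mA yi|exact/Ur/ltW].
have Bu := maximum_lt_upper cov mA yu.
have [i /andP[yi iu]] := filter_ex (between_parts mA.1 Bu).
by exists (x i); split; [exact: maximum_lt_upper mA yi|exact: Uu (ltW yi) iu].
Qed.

Lemma LOTS_right_interval_nbhs (d : Order.disp_t) (X : orderTopologicalType d)
  (y : X) : right_interval_nbhs y.
Proof.
move=> U; rewrite itv_nbhsE => -[[l u] [oi yi] iU].
case: u oi yi iU => [[] u|[]]; rewrite ?itv_boundlr //=.
- move=> _ /andP[ly yu] iU; right; exists u => // w yw wu; apply: iU => /=.
  by rewrite itv_boundlr (le_trans ly) //= bnd_simp.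
- by case: l => [[]|[]].
- by move=> _; rewrite andbF.
- move=> _ /andP[ly _] iU; left=> w yw; apply: iU => /=.
  by rewrite itv_boundlr (le_trans ly) //= bnd_simp.
Qed.

Lemma LOTS_left_interval_nbhs (d : Order.disp_t) (X : orderTopologicalType d)
  (y : X) : right_interval_nbhs (y : X^d).
Proof.
move=> U; rewrite [nbhs _](itv_nbhsE (y : X)) => -[[l u] [oi yi] iU].
case: l oi yi iU => [[] l|[]]; rewrite ?itv_boundlr //=.
- move=> _ /andP[ly yu] iU; right; exists l => // w yw wu; apply: iU => /=.
  rewrite itv_boundlr (le_trans _ yu) ?andbT //= bnd_simp //.
- move=> _ yu iU; left=> w yw; apply: iU => /=.
  by rewrite itv_boundlr (le_trans _ yu) //= bnd_simp.
Qed.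

Section LOTS_convergence.
Context {d : Order.disp_t} {X : orderTopologicalType d} {I : Type}.
Context (D : set_system I) {UD : UltraFilter D} (x : I -> X).
Local Notation A := (lower_part D x).
Local Notation B := (upper_part D x).

Let GO : GO_space X := orderTopological_GO_space X.

Lemma LOTS_maximum_closure y :
  A `|` B = setT -> is_maximum A y -> closure B y.
Proof. exact/maximum_closure_upper/LOTS_right_interval_nbhs. Qed.

Lemma LOTS_minimum_closure y :
  A `|` B = setT -> is_minimum B y -> closure A y.
Proof.
rewrite setUC; apply: (@maximum_closure_upper _ X^d).
exact: LOTS_left_interval_nbhs.
Qed.

(** Besides the closure conditions being automatic, a limit which is not a value
    of D-many x_i forces A and B to cover X: a point outside both would be
    another limit. *)
Lemma LOTS_cvg (y : X) : x @ D --> y <->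
  D [set i | x i = y] \/
  (is_maximum A y /\ A `|` B = setT) \/ (is_minimum B y /\ A `|` B = setT).
Proof.
rewrite cvg_eventually_eq_or_extremum //; split; last first.
  move=> [Ey|[[m cov]|[m cov]]]; first by left.
    by right; left; split=> //; exact: LOTS_maximum_closure.
  by right; right; split=> //; exact: LOTS_minimum_closure.
have [cov|ncov] := pselect (A `|` B = setT).
  by move=> [Ey|[[m _]|[m _]]]; [left|right; left|right; right].
move=> /(cvg_eventually_eq_or_extremum x GO) xy; left.
have [z nz] : exists z, ~ (A `|` B) z.
  by apply/existsNP => h; apply: ncov; apply/seteqP; split=> // z _; exact: h.
have Ez : D [set i | x i = z] by apply/setC_parts => //; exact: le_total.
by rewrite (cvg_unique (@order_hausdorff _ X) xy (eventually_eq_cvg Ez)).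
Qed.

(** An open cut that is not a gap has an extremum in one of its parts, and this
    is a limit. *)
Lemma LOTS_ex_cvg_not_gap : (exists y : X, x @ D --> y) <-> ~ is_gap A B.
Proof.
split=> [/(ex_cvg_not_gap x GO)[]//|ng]; apply: contrapT => ncvg.
have cut : is_open_cut A B by exact: not_cvg_open_cut.
have [_ _ cov _] := cut.
by apply: ng; split=> // -[m mP]; apply: ncvg; exists m; apply/LOTS_cvg;
  [right; left|right; right].
Qed.

End LOTS_convergence.

Theorem proposition3p1 (d : Order.disp_t) (I : Type) (D : set_system I)
    (UD : UltraFilter D) :
  (* statements (1)-(6): X is a linearly ordered set *)
  (forall (X : orderType d) (x : I -> X),
    let A := lower_part D x in
    let B := upper_part D x in
    (forall y : X, (setT `\` (A `|` B)) y <-> D [set i | x i = y]) /\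
    ((setT `\` (A `|` B)) #<= `I_1)%card /\
    (forall y : X, (setT `\` (A `|` B)) y ->
      (forall a, A a -> a < y) /\ (forall b, B b -> y < b)) /\
    (forall a b : X, A a -> B b ->
      D [set i | a < x i < b] /\ [set i | a < x i < b] !=set0) /\
    (forall a b : X, A a -> B b -> a < b) /\
    (A `|` B = setT ->
      ~ (exists m, is_maximum A m) \/ ~ (exists m, is_minimum B m))) /\
  (* statements (7), (9) and (10): X is a GO space *)
  (forall (X : POrderedTopological.type d) (x : I -> X), GO_space X ->
    let A := lower_part D x in
    let B := upper_part D x in
    (forall y : X,
      let Ca := D [set i | x i = y] in
      let Cb := is_maximum A y /\ closure B y in
      let Cc := is_minimum B y /\ closure A y in
      (x @ D --> y <-> Ca \/ Cb \/ Cc) /\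
      ~ (Ca /\ Cb) /\ ~ (Ca /\ Cc) /\ ~ (Cb /\ Cc)) /\
    ((exists y : X, x @ D --> y) <-> ~ is_gap A B /\ ~ is_pseudo_gap A B) /\
    (A `|` B = setT -> forall y : X,
      x @ D --> y <-> limit_point_along D (tail_intervals D x) y)) /\
  (* statements (8) and (9): X is a LOTS *)
  (forall (X : orderTopologicalType d) (x : I -> X),
    let A := lower_part D x in
    let B := upper_part D x in
    (forall y : X, x @ D --> y <->
      D [set i | x i = y] \/
      (is_maximum A y /\ A `|` B = setT) \/
      (is_minimum B y /\ A `|` B = setT)) /\
    ((exists y : X, x @ D --> y) <-> ~ is_gap A B)).
Proof.
split; [|split] => X x.
- have tot : total (<=%O : rel X) := @le_total _ X.
  move=> A B; split; [|split; [|split; [|split; [|split]]]].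
  + exact: setC_parts.
  + apply: subset1_card_le1 => y z /(setC_parts x tot) Ey /(setC_parts x tot).
    exact: eventually_eq_unique.
  + move=> y /(setC_parts x tot) Ey; split=> z.
      exact: eventually_eq_gt.
    exact: eventually_eq_lt.
  + move=> a b Aa Bb; have ab : D [set i | a < x i < b] by exact: between_parts.
    split=> //.
    exact: filter_ex ab.
  + exact: lower_lt_upper.
  + move=> cov; have [[m mA]|] := pselect (exists m, is_maximum A m).
      by right=> -[n]; exact: no_maximum_and_minimum mA.
    by left.
- move=> GO A B; split; [|split].
  + move=> y Ca Cb Cc; split; [exact: cvg_eventually_eq_or_extremum|].
    split; [|split].
    * by move=> [Ey [[/lower_not_eventually_eq]]].
    * by move=> [Ey [[/upper_not_eventually_eq]]].
    * by move=> [[[/lower_notin_upper + _] _] [[]]].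
  + exact: ex_cvg_not_gap.
  + by move=> cov y; exact: cvg_limit_point.
- move=> A B; split; first by move=> y; exact: LOTS_cvg.
  exact: LOTS_ex_cvg_not_gap.
Qed.
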